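(* For all $n\ge 1$, $NTI_{2n+1,\mu}(q)|_{q^n} = C_n$, where $C_n = \frac{1}{n+1}\binom{2n}{n}$ is the $n$th Catalan number.
   Context: For $m\ge 1$, an $m$-cycle in the symmetric group $S_m$ is written $C=(c_0,c_1,\dots,c_{m-1})$ with $c_0=1$, viewed as a cyclic arrangement of $\{1,\dots,m\}$ read from left to right cyclically. We say $c_s$ is cyclically between $c_i$ and $c_j$ if $i<s<j$, or $j<i<s$, or $s<j<i$. For $a<b$ in $\{1,\dots,m\}$, the pair $\langle a,b\rangle$ is an occurrence of $\mu$ in $C$ if there is no $x$ with $a<x<b$ that is cyclically between $a$ and $b$ in $C$; it is nontrivial if $a+1<b$. $NT_\mu(C)$ denotes the number of nontrivial occurrences of $\mu$ in $C$. An $m$-cycle is incontractible if there is no $i$ with $1\le i\le m-1$ such that $i+1$ immediately follows $i$ in $C$; $\mathcal{IC}_m$ is the set of incontractible $m$-cycles in $S_m$. Define $NTI_{m,\mu}(q)=\sum_{C\in\mathcal{IC}_m} q^{NT_\mu(C)}$; $f(q)|_{q^k}$ means the coefficient of $q^k$ in $f(q)$. *)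

(* Defs.v *)
From HB Require Import structures.
From mathcomp Require Import all_boot all_order all_fingroup all_algebra.

Set Implicit Arguments.
Unset Strict Implicit.
Unset Printing Implicit Defensive.

Import GRing.Theory.
Local Open Scope ring_scope.

(* Up to NTI_mu, the number of letters is m.+1 (so it is at least 1), and the *)
(* letters 1, ..., m.+1 are encoded, in order, as the ordinals 0, ..., m.      *)

Definition full_cycle (m : nat) (C : 'S_m.+1) : bool :=
  porbits C == [set [set: 'I_m.+1]].

(* [:: c_0; ...; c_m] with c_0 the smallest letter and c_(i+1) = C c_i, where  *)
(* C = (c_0, ..., c_m) in cycle notation.                                      *)
Definition cycle_word (m : nat) (C : 'S_m.+1) : seq 'I_m.+1 :=
  traject C ord0 m.+1.

Definition pos (m : nat) (C : 'S_m.+1) (x : 'I_m.+1) : nat :=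
  index x (cycle_word C).

Definition cyc_between (m : nat) (C : 'S_m.+1) (a x b : 'I_m.+1) : bool :=
  let i := pos C a in let s := pos C x in let j := pos C b in
  [|| (i < s < j)%N, (j < i < s)%N | (s < j < i)%N].

Definition mu_occ (m : nat) (C : 'S_m.+1) (a b : 'I_m.+1) : bool :=
  (a < b)%N && ~~ [exists x : 'I_m.+1, (a < x < b)%N && cyc_between C a x b].

Definition NT_mu (m : nat) (C : 'S_m.+1) : nat :=
  #|[set ab : 'I_m.+1 * 'I_m.+1 | mu_occ C ab.1 ab.2 & (ab.1.+1 < ab.2)%N]|.

(* "i+1 immediately follows i in C" is C i = i+1.                              *)
Definition incontractible (m : nat) (C : 'S_m.+1) : bool :=
  ~~ [exists i : 'I_m.+1, (i.+1 < m.+1)%N && (C i == i.+1 :> nat)].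

Definition IC (m : nat) : {set 'S_m.+1} :=
  [set C : 'S_m.+1 | full_cycle C & incontractible C].

(* Here m itself is the number of letters; the value at m = 0 is junk.         *)
Definition NTI_mu (m : nat) : {poly int} :=
  if m is p.+1 then \sum_(C in IC p) 'X^(NT_mu C) else 0.

Definition catalan (n : nat) : rat := (n.+1)%:R^-1 * 'C((2 * n)%N, n)%:R.

(* Main.v *)
(* For each letter i that is not the largest, the arc of the cycle from i to  *)
(* i+1 is nonempty.  If it contains a letter greater than i+1, the least such *)
(* x gives a nontrivial occurrence <i, x>; if it contains a letter less than  *)
(* i, the greatest such y gives a nontrivial occurrence <y, i+1>.  As there   *)
(* are 2n arcs, having only n nontrivial occurrences forces every arc to      *)
(* contain only larger letters (i is open) or only smaller letters (i is      *)
(* closed).  In such a cycle the nontrivial occurrences are exactly the       *)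
(* pairs <i, C i> with i open.                                                *)
(* Build the cycle by inserting 0, 1, 2, ... in order.  If i is open, i+1 is  *)
(* inserted right after i; if i is closed, i+1 is inserted right after an     *)
(* open letter y which has C y = i+1, and y has to be the oldest open letter  *)
(* whose successor is still missing, since an older one would lie in the arc  *)
(* from i to i+1 together with its successor, which is greater than i+1.      *)
(* So the waiting open letters form a first-in-first-out queue, the cycle is  *)
(* determined by the open/closed word, and the words that occur are those for *)
(* which the queue is never popped when empty and is empty at the end, i.e.   *)
(* the Dyck words.                                                            *)
Require Import Defs.
From mathcomp Require Import all_boot all_order all_fingroup all_algebra.
From mathcomp Require Import zify.
Import GRing.Theory Num.Theory.

Set Implicit Arguments.
Unset Strict Implicit.
Unset Printing Implicit Defensive.

(** The coefficient counts the incontractible cycles on 2n+1 letters with exactly n nontrivial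
    occurrences. Arcs holding a larger letter give occurrences with distinct first entries, and arcs
    holding a smaller letter give occurrences with distinct second entries ([card_up_le_NT],
    [card_dn_le_NT]). Each of the 2n arcs is of one kind or the other, so a total of n forces n arcs
    of each kind and none of both. Conversely, when no arc is of both kinds and none is empty, an
    occurrence is determined by its open first entry ([mu_occ_arc]), and the Dyck property makes n
    letters open. This is [minimal_NT]. Such cycles correspond to Dyck words of length 2n through
    the record of open letters. The queue argument shows that the record is a Dyck word
    ([dyck_of_word]) and determines the cycle ([word_up_inj]); running the queue on any Dyck word
    builds a cycle with that record ([word_of_dyck]). Dyck words are counted by ballot numbers
    ([card_dyck_catalan]). *)

Definition cyc (i s j : nat) : bool := [|| i < s < j, j < i < s | s < j < i].

Definition btw (w : seq nat) (a x b : nat) : bool :=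
  cyc (index a w) (index x w) (index b w).

Definition wordp (m : nat) (w : seq nat) : bool :=
  perm_eq w (iota 0 m.+1) && (index 0 w == 0).

(** Once arcs are monotone, [up w i] means that i is open, and [dn w i] that it is closed. *)
Definition up (w : seq nat) (i : nat) : bool :=
  has (fun x => (i.+1 < x) && btw w i x i.+1) w.
Definition dn (w : seq nat) (i : nat) : bool :=
  has (fun x => (x < i) && btw w i x i.+1) w.

(** The exclusive or also excludes empty arcs, so incontractibility is built in. *)
Definition monotone_arcs (m : nat) (w : seq nat) : bool :=
  all (fun i => up w i != dn w i) (iota 0 m).

(* The open letters j < i that still wait for their successor, oldest first. *)
Fixpoint fifo (t : nat -> bool) (i : nat) : seq nat :=
  if i is j.+1 then if t j then rcons (fifo t j) j else behead (fifo t j)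
  else [::].

(* The letter after which i+1 is inserted; junk when the queue is empty. *)
Definition anchor (t : nat -> bool) (i : nat) : nat :=
  if t i then i else head 0 (fifo t i).

Fixpoint ins (k a : nat) (w : seq nat) : seq nat :=
  if w is x :: w' then if x == a then x :: k :: w' else x :: ins k a w'
  else [::].

Fixpoint build (t : nat -> bool) (i : nat) : seq nat :=
  if i is j.+1 then ins i (anchor t j) (build t j) else [:: 0].

(** The starting height [h] stands for the number of letters already in the queue. *)
Fixpoint dyck (h : nat) (s : seq bool) : bool :=
  match s with
  | [::] => h == 0
  | true :: s' => dyck h.+1 s'
  | false :: s' => if h is h'.+1 then dyck h' s' else false
  end.

(** * Positions in a cyclic word, insertion and successors *)

Lemma mem_word m w x : wordp m w -> (x \in w) = (x <= m).
Proof. by case/andP=> /perm_mem-> _; rewrite mem_iota; lia. Qed.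

Lemma uniq_word m w : wordp m w -> uniq w.
Proof. by case/andP=> /perm_uniq-> _; rewrite iota_uniq. Qed.

Lemma index_neq m w x y :
  wordp m w -> x <= m -> x != y -> index x w != index y w.
Proof.
move=> Hw xm; apply: contra => /eqP e; apply/eqP.
have xw : x \in w by rewrite (mem_word _ Hw).
have yw : y \in w by rewrite -index_mem -e index_mem.
exact: index_inj e.
Qed.

Lemma perm_ins k a w : a \in w -> perm_eq (ins k a w) (k :: w).
Proof.
move=> aw; apply/seq.permP => p; elim: w aw => //= x w IH; rewrite inE eq_sym.
case: (x == a) => /= [_|aw]; first by lia.
by rewrite IH //=; lia.
Qed.

Lemma index_ins_new k a w :
  a \in w -> k \notin w -> index k (ins k a w) = (index a w).+1.
Proof.
elim: w => //= x w IH; rewrite !inE negb_or.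
rewrite (eq_sym a) (eq_sym k); case: (eqVneq x a) => [<- _|_ /= aw] /andP[/negPf nk kw] /=.
  by rewrite nk eqxx.
by rewrite nk IH.
Qed.

Lemma index_ins_old k a w x : a \in w -> k \notin w -> x \in w ->
  index x (ins k a w) = index x w + (index a w < index x w).
Proof.
elim: w => //= y w IH; rewrite !inE negb_or.
rewrite (eq_sym a) (eq_sym k) (eq_sym x).
case: (eqVneq y a) => [<- _|_ /= aw] /andP[/negPf nk kw] /=.
  case: (eqVneq y x) => //= _ xw; case: (eqVneq k x) => [e|_]; last by lia.
  by rewrite e xw in kw.
by case: (eqVneq y x) => //= _ xw; rewrite IH.
Qed.

Lemma wordp_ins m w a : wordp m w -> a <= m -> wordp m.+1 (ins m.+1 a w).
Proof.
move=> Hw am; have aw : a \in w by rewrite (mem_word _ Hw).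
have mw : m.+1 \notin w by rewrite (mem_word _ Hw) ltnn.
have zw : 0 \in w by rewrite (mem_word _ Hw).
have [Hp /eqP H0] := andP Hw; apply/andP; split; last first.
  by rewrite index_ins_old // H0.
apply: (perm_trans (perm_ins _ aw)).
apply/seq.permP => p; rewrite -[m.+2]addn1 iotaD count_cat -(seq.permP Hp p) /=.
by rewrite add0n; lia.
Qed.

Lemma next_word m w y : wordp m w -> 0 < m -> y <= m ->
  [/\ next w y <= m, next w y != y &
      forall x, x <= m -> ~~ btw w y x (next w y)].
Proof.
move=> Hw m0 ym; have yw : y \in w by rewrite (mem_word _ Hw).
have uw := uniq_word Hw.
have sw : size w = m.+1.
  by case/andP: Hw => /perm_size->; rewrite size_iota.
have nw : next w y \in w by rewrite mem_next.
have ixn : index (next w y) w = if (index y w).+1 == m.+1 then 0 else (index y w).+1.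
  case: w {Hw} yw uw sw nw => // z w yw uw [sw] nw.
  rewrite next_nth yw.
  have iy : index y (z :: w) <= m by move: yw; rewrite -index_mem /= sw; lia.
  case: eqP => [e|ne].
    by rewrite nth_default ?index_head // sw -ltnS e.
  rewrite -[nth z w _]/(nth z (z :: w) (index y (z :: w)).+1) index_uniq //.
  by rewrite /= sw ltnS ltn_neqAle iy andbT; apply/eqP => /(congr1 S)/ne.
have iy : index y w <= m by move: yw; rewrite -index_mem sw.
split.
- by rewrite -(mem_word _ Hw).
- by apply/eqP => e; move: ixn; rewrite e; case: eqP; lia.
move=> x; rewrite -(mem_word _ Hw) -index_mem sw ltnS => ix.
by rewrite /btw /cyc ixn; case: eqP; lia.
Qed.

Lemma prev_word m w y : wordp m w -> 0 < m -> y <= m ->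
  exists2 z, z <= m & next w z = y.
Proof.
move=> Hw m0 ym; exists (prev w y).
  by rewrite -(mem_word _ Hw) mem_prev (mem_word _ Hw).
by rewrite next_prev // (uniq_word Hw).
Qed.

(** * Arcs of a cycle and the queue of waiting letters *)

Lemma btw_ends w a x b : btw w a x b -> (x != a) && (x != b).
Proof. by move=> h; apply/andP; split; apply: contraTneq h => ->; rewrite /btw /cyc; lia. Qed.

Lemma index_ltn_neq m w x y :
  wordp m w -> y <= m -> x < y -> index x w != index y w.
Proof. by move=> Hw ym xy; apply: (index_neq Hw); lia. Qed.

Lemma upP m w i x : wordp m w -> monotone_arcs m w -> i < m -> up w i ->
  x <= m -> btw w i x i.+1 -> i.+1 < x.
Proof.
move=> Hw /allP/(_ i) Hm im ui xm xi; have /andP[x1 x2] := btw_ends xi.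
have : ~~ dn w i by have := Hm; rewrite mem_iota im ui => /(_ isT); case: dn.
move=> /hasPn/(_ x); rewrite (mem_word _ Hw) xm xi andbT => /(_ isT).
by lia.
Qed.

Lemma dnP m w i x : wordp m w -> i < m -> ~~ up w i ->
  x <= m -> btw w i x i.+1 -> x < i.
Proof.
move=> Hw im ui xm xi; have /andP[x1 x2] := btw_ends xi.
move/hasPn: ui => /(_ x); rewrite (mem_word _ Hw) xm xi andbT => /(_ isT).
by lia.
Qed.

Lemma arc_next m w i b : wordp m w -> 0 < m -> i <= m -> b <= m ->
  (exists2 x, x <= m & btw w i x b) -> btw w i (next w i) b.
Proof.
move=> Hw m0 im bm [x xm xi].
have [nm ni Hn] := next_word Hw m0 im.
have [e|ne] := eqVneq (next w i) b; first by move: (Hn x xm); rewrite e xi.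
have /andP[x1 x2] := btw_ends xi; move: (Hn x xm) (Hn b bm) xi.
have := index_neq Hw nm ni; have := index_neq Hw nm ne.
have := index_neq Hw xm x1; have := index_neq Hw xm x2.
by rewrite /btw /cyc; lia.
Qed.

(* Besides being sorted, the waiting letters occur in increasing order when  *)
(* the cycle is read from i.                                                  *)
Definition queue_inv (w : seq nat) (i : nat) (q : seq nat) : Prop :=
  (forall y, (y \in q) = (y < i) && (i < next w y)) /\
  pairwise (fun y z => (y < z) && btw w y z i) q.

(** No smaller letter lies on the arc from i to i+1. Hence reading from i+1 meets the letters below
    i in the same order as reading from i, and then i itself, which therefore joins the end of the
    queue. *)
Lemma queue_inv_up m w i q : wordp m w -> monotone_arcs m w -> i < m ->
  up w i -> queue_inv w i q -> queue_inv w i.+1 (rcons q i).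
Proof.
move=> Hw Hm im ui [Hq Hs]; have m0 : 0 < m by lia.
have Har x := upP Hw Hm im ui (x := x).
have qi y : y \in q -> y < i by rewrite Hq => /andP[].
have early y : y < i -> btw w y i i.+1.
  move=> yi; have := Har y (ltac:(lia)).
  have := @index_neq m w y i Hw ltac:(lia) ltac:(lia).
  have := @index_neq m w y i.+1 Hw ltac:(lia) ltac:(lia).
  have := @index_neq m w i i.+1 Hw ltac:(lia) ltac:(lia).
  by rewrite /btw /cyc; lia.
split=> [y|].
  rewrite mem_rcons inE Hq ltnS; have [->|ne] := eqVneq y i.
    have [nm ni Hn] := next_word Hw m0 (ltnW im).
    have : btw w i (next w i) i.+1.
      apply: (arc_next Hw) => //; first by lia.
      by case/hasP: ui => x; rewrite (mem_word _ Hw) => xm /andP[_]; exists x.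
    by move=> /(Har _ nm)->; rewrite leqnn.
  rewrite [y <= i]leq_eqVlt (negPf ne) /=; have [yi /=|//] := boolP (y < i).
  have [nm ny Hn] := next_word Hw m0 (ltac:(lia) : y <= m).
  have := Hn i (ltnW im); rewrite leq_eqVlt; case: eqVneq => //= <-.
  by rewrite early.
rewrite pairwise_rcons; apply/andP; split.
  by apply/allP=> y yq; rewrite qi //= early // qi.
apply: (sub_in_pairwise _ (allss q)) Hs => y z yq zq /andP[-> yz] /=.
move: (early y (qi _ yq)) (early z (qi _ zq)) yz.
by rewrite /btw /cyc; lia.
Qed.

(** The predecessor of i+1 is the last letter of the arc from i to i+1, hence smaller than i, and it
    waits because its successor exceeds i. An older waiting letter would be met before it, putting
    its own large successor on the arc. *)
Lemma queue_inv_dn m w i q : wordp m w -> i < m -> ~~ up w i -> dn w i ->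
  queue_inv w i q ->
  [/\ q != [::], next w (head 0 q) = i.+1, head 0 q < i &
      queue_inv w i.+1 (behead q)].
Proof.
move=> Hw im ui di [Hq Hs]; have m0 : 0 < m by lia.
have Har x := dnP Hw im ui (x := x).
have [y ym ny] := prev_word Hw m0 im.
have [_ _ Hny] := next_word Hw m0 ym; rewrite ny in Hny.
have [x xm xi] : exists2 x, x <= m & btw w i x i.+1.
  by case/hasP: di => x; rewrite (mem_word _ Hw) => xm /andP[_]; exists x.
have yi : btw w i y i.+1.
  have [->//|nxy] := eqVneq y x.
  have ny' : y != i.+1 by apply/eqP=> e; have [] := next_word Hw m0 ym; rewrite ny e eqxx.
  move: (index_neq Hw ym nxy) (index_neq Hw ym ny') (Hny x xm) (Hny i (ltnW im)) xi.
  by rewrite /btw /cyc; lia.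
have yq : y \in q by rewrite Hq ny leqnn andbT; exact: Har.
have hy : head 0 q = y.
  case: q Hq Hs yq => //= z q Hq /andP[/allP Hz _]; rewrite inE.
  case: eqVneq => //= nyz /Hz/andP[zy zyi].
  have /andP[zi nzi] : (z < i) && (i < next w z) by rewrite -Hq mem_head.
  have zm : z <= m by lia.
  have [nm nz Hn] := next_word Hw m0 zm.
  suff : btw w i (next w z) i.+1 by move=> /(Har _ nm); lia.
  have ne : next w z != i.+1.
    apply/eqP => e; have := can_inj (prev_next (uniq_word Hw)) (etrans e (esym ny)).
    by lia.
  move: (index_neq Hw nm ne) (index_neq Hw nm nz) (Hn _ im) (Hn _ (ltnW im)).
  move: (@index_neq m w z i.+1 Hw zm ltac:(lia)) (@index_neq m w z i Hw zm ltac:(lia)).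
  move: (Hny z zm) zyi yi.
  by rewrite /btw /cyc; lia.
have yli : y < i by apply: Har.
rewrite hy; split=> //; first by case: (q) yq.
case: q Hq Hs yq hy => //= z q Hq /andP[/allP Hz Hs] yq ezy; rewrite {}ezy in Hq Hz yq.
have zq : y \notin q by apply/negP => /Hz; lia.
split=> [x'|].
  rewrite ltnS; have := Hq x'; rewrite inE.
  have [->|ne] := eqVneq x' y; first by rewrite (negPf zq) ny ltnn andbF.
  move=> /= ->; have [->|ni] := eqVneq x' i.
    (* The successor of i lies on its arc and so is smaller than i: i never waits. *)
    rewrite ltnn leqnn /=; symmetry; apply/negbTE.
    have : btw w i (next w i) i.+1 by apply: (arc_next Hw) => //; [lia | exists x].
    by have [nm _ _] := next_word Hw m0 (ltnW im); move=> /(Har _ nm); lia.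
  rewrite [x' <= i]leq_eqVlt (negPf ni) /=; have [x'i /=|//] := boolP (x' < i).
  rewrite leq_eqVlt; case: eqVneq => //= e.
  by have := can_inj (prev_next (uniq_word Hw)) (etrans (esym e) (esym ny)); lia.
apply: (sub_in_pairwise _ (allss q)) Hs => a b aq bq /andP[-> ab] /=.
have /andP[_ ya] := Hz _ aq; have /andP[_ yb] := Hz _ bq.
have am : a < i by have := Hq a; rewrite inE aq orbT => /esym/andP[].
have bm : b < i by have := Hq b; rewrite inE bq orbT => /esym/andP[].
have aM := leq_trans (ltnW am) (ltnW im); have bM := leq_trans (ltnW bm) (ltnW im).
move: (Hny a aM) (Hny b bM) (Hny i (ltnW im)).
move: (index_ltn_neq Hw im (leqW am)) (index_ltn_neq Hw im (leqW bm)).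
move: ab ya yb yi; rewrite /btw /cyc; clear; lia.
Qed.

Lemma queue_inv_fifo m w i : wordp m w -> monotone_arcs m w -> i <= m ->
  queue_inv w i (fifo (up w) i).
Proof.
move=> Hw Hm; elim: i => [_|i IH im]; first by split=> // y; rewrite in_nil.
have := IH (ltnW im) => {}IH.
rewrite /=; have [ui|ui] := ifPn; first exact: (queue_inv_up Hw).
have di : dn w i.
  by move/allP/(_ i): Hm; rewrite mem_iota im => /(_ isT); case: dn => //; rewrite (negPf ui).
by have [] := queue_inv_dn Hw im ui di IH.
Qed.

(** The height of the path is the length of the queue. As [behead] is silent on an empty queue, the
    absence of such pops is a separate conjunct. *)
Lemma dyck_fifo t i k :
  dyck (size (fifo t i)) (map t (iota i k)) =
  all (fun j => t j || (fifo t j != [::])) (iota i k) && (fifo t (i + k) == [::]).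
Proof.
elim: k i => [|k IH] i /=; first by rewrite addn0 size_eq0.
rewrite addnS -addSn; have := IH i.+1; rewrite /=.
case: (t i) => /=; first by rewrite size_rcons.
by case: (fifo t i) => //= a q ->.
Qed.

Lemma dyck_of_word m w : wordp m w -> monotone_arcs m w ->
  dyck 0 (map (up w) (iota 0 m)).
Proof.
move=> Hw Hm; rewrite -[0]/(size (fifo (up w) 0)) dyck_fifo add0n.
apply/andP; split.
  apply/allP => i; rewrite mem_iota => /= im.
  have [//|ui] := boolP (up w i).
  have di : dn w i.
    by move/allP/(_ i): Hm; rewrite mem_iota im => /(_ isT); case: dn => //; rewrite (negPf ui).
  by have [] := queue_inv_dn Hw im ui di (queue_inv_fifo Hw Hm (ltnW im)).
(* A letter left at the end would need a successor greater than m. *)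
have [Hq _] := queue_inv_fifo Hw Hm (leqnn m).
case: (fifo _ _) Hq => // y q /(_ y); rewrite mem_head => /esym/andP[ym].
have [nm _ _] := next_word Hw (ltac:(lia)) (ltnW ym).
by lia.
Qed.

Lemma anchor_word m w i : wordp m w -> monotone_arcs m w -> i < m ->
  anchor (up w) i <= i /\
  forall x, x <= i -> ~~ btw w (anchor (up w) i) x i.+1.
Proof.
move=> Hw Hm im; rewrite /anchor; have m0 : 0 < m by lia.
have IH := queue_inv_fifo Hw Hm (ltnW im).
have [ui|ui] := ifPn.
  split=> // x xi; apply/negP => xb.
  by have := upP Hw Hm im ui (leq_trans xi (ltnW im)) xb; lia.
have di : dn w i.
  by move/allP/(_ i): Hm; rewrite mem_iota im => /(_ isT); case: dn => //; rewrite (negPf ui).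
have [_ ny yi _] := queue_inv_dn Hw im ui di IH; split=> [|x xi]; first exact: ltnW.
have [_ _ Hn] := next_word Hw m0 (leq_trans (ltnW yi) (ltnW im)).
by rewrite -ny; apply: Hn; exact: leq_trans xi (ltnW im).
Qed.

(** * A cycle is determined by its open letters *)

Lemma btw_rot w x y z : btw w x y z = btw w y z x.
Proof. by rewrite /btw /cyc; lia. Qed.

Lemma btw_xx w x y : btw w x x y = false.
Proof. by rewrite /btw /cyc; lia. Qed.

(** Among the letters up to [k], [k] comes right after [a], so it compares with the others as [a]
    does. *)
Lemma btw_anchor m w k a x y : wordp m w -> k <= m -> a < k ->
  (forall z, z < k -> ~~ btw w a z k) -> x < k -> y < k ->
  btw w k x y = [&& x != a, x != y & (y == a) || btw w a x y].
Proof.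
move=> Hw km ak Ha xk yk.
move: (Ha x xk) (Ha y yk) (index_ltn_neq Hw km xk) (index_ltn_neq Hw km yk) (index_ltn_neq Hw km ak).
have [->|xa] := eqVneq x a; first by rewrite /btw /cyc /=; clear; lia.
have [->|xy] := eqVneq x y; first by rewrite /btw /cyc /=; clear; lia.
have := index_neq Hw (leq_trans (ltnW xk) km) xy.
have := index_neq Hw (leq_trans (ltnW xk) km) xa.
have [->|ya] := eqVneq y a; first by rewrite /btw /cyc /=; clear; lia.
have := index_neq Hw (leq_trans (ltnW yk) km) ya.
by rewrite /btw /cyc /=; clear; lia.
Qed.

Lemma sorted_index (w : seq nat) :
  uniq w -> sorted (fun x y => index x w < index y w) w.
Proof.
by move=> uw; apply/(sortedP 0) => i iw; rewrite !index_uniq // ltnW.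
Qed.

(** Both words start with 0, so the cyclic order of 0, x, y recovers the linear order of
    positions. *)
Lemma word_eq m w w' : wordp m w -> wordp m w' ->
  (forall x y z, x <= m -> y <= m -> z <= m -> btw w x y z = btw w' x y z) ->
  w = w'.
Proof.
move=> Hw Hw' E; have [_ /eqP w0] := andP Hw; have [_ /eqP w0'] := andP Hw'.
have idx x y : x <= m -> y <= m ->
    (index x w < index y w) = (index x w' < index y w').
  move=> xm ym; have := E 0 x y (leq0n _) xm ym.
  have h v z : index 0 v = 0 -> wordp m v -> z <= m -> (index z v == 0) = (z == 0).
    move=> v0 Hv zm; rewrite -{1}v0; case: (eqVneq z 0) => [->|nz].
      by rewrite eqxx.
    exact/negbTE/(index_neq Hv).
  move: (h w x w0 Hw xm) (h w y w0 Hw ym) (h w' x w0' Hw' xm) (h w' y w0' Hw' ym).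
  by rewrite /btw /cyc w0 w0'; clear; lia.
apply: (irr_sorted_eq (leT := fun x y => index x w < index y w)).
- by move=> y x z; apply: ltn_trans.
- by move=> x; rewrite ltnn.
- exact: sorted_index (uniq_word Hw).
- apply: sub_in_sorted (allss w') (sorted_index (uniq_word Hw')) => x y.
  by rewrite !(mem_word _ Hw') => xm ym; rewrite idx.
by move=> x; rewrite (mem_word _ Hw) (mem_word _ Hw').
Qed.

(** Induction on the largest letter considered: by [btw_anchor], the place of i+1 is fixed by the
    cyclic order of the letters up to i and the anchor [f i]. *)
Lemma word_anchor_inj m w w' (f : nat -> nat) : wordp m w -> wordp m w' ->
  (forall i, i < m -> f i <= i) ->
  (forall i x, i < m -> x <= i -> ~~ btw w (f i) x i.+1) ->
  (forall i x, i < m -> x <= i -> ~~ btw w' (f i) x i.+1) ->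
  w = w'.
Proof.
move=> Hw Hw' fi fw fw'; apply: (word_eq Hw Hw').
suff: forall i, i <= m -> forall x y z, x <= i -> y <= i -> z <= i ->
    btw w x y z = btw w' x y z by move=> /(_ m (leqnn m)).
elim=> [_ x y z|i IH im x y z].
  by rewrite !leqn0 => /eqP-> /eqP-> /eqP->; rewrite !btw_xx.
have fim := fi i im.
have new a b : a <= i -> b <= i -> btw w i.+1 a b = btw w' i.+1 a b.
  move=> ai bi; rewrite (btw_anchor (a := f i) Hw im) //; last by move=> c; rewrite ltnS; exact: fw.
  rewrite (btw_anchor (a := f i) Hw' im) //; last by move=> c; rewrite ltnS; exact: fw'.
  by rewrite IH // ltnW.
have new' a b : a <= i.+1 -> b <= i.+1 -> btw w i.+1 a b = btw w' i.+1 a b.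
  rewrite leq_eqVlt => /orP[/eqP->|ai]; first by rewrite !btw_xx.
  rewrite leq_eqVlt => /orP[/eqP->|bi]; last exact: new.
  by rewrite -[RHS]btw_rot -[LHS]btw_rot !btw_xx.
rewrite leq_eqVlt => /orP[/eqP->|xi] yi zi; first exact: new'.
rewrite leq_eqVlt in yi; case/orP: yi => [/eqP yi|yi].
  by rewrite yi btw_rot [RHS]btw_rot new' // ltnW.
rewrite leq_eqVlt in zi; case/orP: zi => [/eqP->|zi].
  by rewrite -btw_rot -[RHS]btw_rot new' // ltnW.
exact: (IH (ltnW im)).
Qed.

Lemma word_up_inj m w w' : wordp m w -> wordp m w' ->
  monotone_arcs m w -> monotone_arcs m w' ->
  (forall i, i < m -> up w i = up w' i) -> w = w'.
Proof.
move=> Hw Hw' Hm Hm' E.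
have Ef i : i <= m -> fifo (up w) i = fifo (up w') i.
  by elim: i => //= i IH im; rewrite E // IH // ltnW.
have Ea i : i < m -> anchor (up w) i = anchor (up w') i.
  by move=> im; rewrite /anchor E // Ef // ltnW.
apply: (word_anchor_inj (f := anchor (up w)) Hw Hw') => [i im|i x im|i x im].
- by have [] := anchor_word Hw Hm im.
- by have [_ ] := anchor_word Hw Hm im; apply.
- by rewrite Ea //; have [_ ] := anchor_word Hw' Hm' im; apply.
Qed.

(** * Building a cycle from a Dyck word *)

Lemma btw_ins_old m w a x y z : wordp m w -> a <= m ->
  x <= m -> y <= m -> z <= m -> btw (ins m.+1 a w) x y z = btw w x y z.
Proof.
move=> Hw; rewrite -!(mem_word _ Hw) => aw xw yw zw.
have mw : m.+1 \notin w by rewrite (mem_word _ Hw) ltnn.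
by rewrite /btw /cyc !index_ins_old //; clear; lia.
Qed.

Lemma btw_ins_new m w a x y : wordp m w -> a <= m ->
  x <= m -> y <= m -> x != y ->
  btw (ins m.+1 a w) x m.+1 y = (x == a) || btw w x a y.
Proof.
move=> Hw am xm ym xy; move: (index_neq Hw xm xy).
have xa : (index x w == index a w) = (x == a).
  by case: (eqVneq x a) => [->|/(index_neq Hw xm)/negbTE]; rewrite ?eqxx.
move: am xm ym xa; rewrite -!(mem_word _ Hw) => aw xw yw.
have mw : m.+1 \notin w by rewrite (mem_word _ Hw) ltnn.
rewrite /btw /cyc index_ins_new // !index_ins_old //; clear.
by lia.
Qed.

(** New letters go only after i or after a waiting letter. Closed arcs contain neither, so they are
    never spoiled; open arcs only gain larger letters. An open arc may still lack a letter beyond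
    j+1 as long as j waits. The cyclic order of the queue keeps the remaining waiting letters off
    each newly closed arc. *)
Record build_inv (t : nat -> bool) (i : nat) (w q : seq nat) : Prop := BuildInv {
  inv_word : wordp i w;
  inv_queue : forall y, y \in q -> (y < i) && t y;
  inv_cyclic : pairwise (fun y z => btw w y z i) q;
  inv_open : forall j, j < i -> t j ->
    (forall x, x <= i -> btw w j x j.+1 -> j < x) /\
    (j \in q \/ exists2 x, x <= i & (j.+1 < x) && btw w j x j.+1);
  inv_close : forall j, j < i -> ~~ t j ->
    [/\ forall x, x <= i -> btw w j x j.+1 -> x < j,
        exists2 x, x < j & btw w j x j.+1,
        forall y, y \in q -> ~~ btw w j y j.+1 & ~~ btw w j i j.+1]
}.

Lemma build_inv_open (t : nat -> bool) i w q : t i -> build_inv t i w q ->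
  build_inv t i.+1 (ins i.+1 i w) (rcons q i).
Proof.
move=> ti [Hw Hq Hc Ho Hd]; have Hw' := wordp_ins Hw (leqnn i).
have qi y : y \in q -> y < i by move/Hq/andP=> [].
have old := btw_ins_old Hw (leqnn i).
have new := btw_ins_new Hw (leqnn i).
split=> //.
- move=> y; rewrite mem_rcons inE => /orP[/eqP->|/Hq/andP[yi ->]].
    by rewrite ltnSn.
  by rewrite (leqW yi).
- rewrite pairwise_rcons; apply/andP; split.
    apply/allP => y /qi yi /=; rewrite btw_rot new ?eqxx //; first exact: ltnW.
    by rewrite gtn_eqF.
  apply: (sub_in_pairwise _ (allss q)) Hc => y z yq zq yz.
  have [zy _] := andP (btw_ends yz).
  by rewrite btw_rot new ?(ltnW (qi _ _)) // -btw_rot yz orbT.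
- move=> j; rewrite ltnS leq_eqVlt => /orP[/eqP-> _|ji tj].
    split; last by left; rewrite mem_rcons mem_head.
    move=> x xi xb; have /andP[x1 x2] := btw_ends xb.
    have {}xi : x <= i by rewrite -ltnS ltn_neqAle x2.
    by move: xb; rewrite btw_rot new // (negPf x1) btw_rot btw_xx.
  have [h1 h2] := Ho j ji tj; split.
    move=> x; rewrite leq_eqVlt => /orP[/eqP-> _|xi]; first exact: leqW.
    by rewrite old ?(ltnW ji) //; apply: h1.
  case: h2 => [jq|[x xi xj]]; first by left; rewrite mem_rcons inE jq orbT.
  by right; exists x; rewrite ?old ?(ltnW ji) // leqW.
move=> j; rewrite ltnS leq_eqVlt => /orP[/eqP->|ji tj]; first by rewrite ti.
have [h1 [x xj h2] h3 h4] := Hd j ji tj; have jm := ltnW ji.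
have xi := ltnW (ltn_trans xj ji).
have nk : ~~ btw (ins i.+1 i w) j i.+1 j.+1.
  by rewrite new // ?ltn_eqF //= negb_or h4 ltn_eqF.
split=> //.
- move=> y; rewrite leq_eqVlt => /orP[/eqP->|yi]; first by rewrite (negPf nk).
  by rewrite old //; apply: h1.
- by exists x; rewrite ?old.
move=> y; rewrite mem_rcons inE => /orP[/eqP->|yq]; first by rewrite old.
by rewrite old ?h3 // ltnW // qi.
Qed.

Lemma build_inv_close (t : nat -> bool) i w a q : ~~ t i -> build_inv t i w (a :: q) ->
  build_inv t i.+1 (ins i.+1 a w) q.
Proof.
move=> ti [Hw Hq Hc Ho Hd].
have /andP[ai ta] := Hq a (mem_head _ _); have am := ltnW ai.
have Hw' := wordp_ins Hw am.
have qi y : y \in q -> y < i by move=> yq; have := Hq y; rewrite inE yq orbT => /(_ isT)/andP[].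
have old := btw_ins_old Hw am.
have new := btw_ins_new Hw am.
move: Hc; rewrite /= => /andP[/allP Ha Hc].
split=> //.
- by move=> y yq; have := Hq y; rewrite inE yq orbT => /(_ isT)/andP[yi ->]; rewrite leqW.
- apply: (sub_in_pairwise _ (allss q)) Hc => y z yq zq yz.
  have [zy _] := andP (btw_ends yz).
  rewrite btw_rot new ?(ltnW (qi _ _)) //.
  move: (Ha y yq) (Ha z zq) yz; rewrite /btw /cyc; clear; lia.
- move=> j; rewrite ltnS leq_eqVlt => /orP[/eqP-> |ji tj]; first by rewrite (negPf ti).
  have [h1 h2] := Ho j ji tj; have jm := ltnW ji; split.
    move=> x; rewrite leq_eqVlt => /orP[/eqP-> _|xi]; first exact: leqW.
    by rewrite old //; apply: h1.
  case: h2 => [|[x xi xj]]; last by right; exists x; rewrite ?old // leqW.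
  (* The popped letter gets i+1 as its successor, which provides the larger letter on its arc. *)
  rewrite inE => /orP[/eqP ej|jq]; [right | by left].
  by exists i.+1 => //; rewrite ltnS ji new ?ej ?eqxx ?ltn_eqF // -ej.
(* The new arc from i to i+1 ends with [a]; reading from i, the other waiting letters come after [a]
   and stay outside. *)
move=> j; rewrite ltnS leq_eqVlt => /orP[/eqP-> _|ji tj].
  split.
  - by move=> x xi /btw_ends/andP[x1 x2]; rewrite ltn_neqAle x1 -ltnS ltn_neqAle x2.
  - by exists a => //; rewrite btw_rot new ?eqxx // ltn_eqF.
  - move=> y yq; have yi := qi y yq; rewrite btw_rot new ?(ltnW yi) ?(ltn_eqF yi) //.
    by move: (Ha y yq) => /[dup]/btw_ends/andP[/negPf-> _]; rewrite /btw /cyc; clear; lia.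
  by rewrite btw_rot btw_xx.
have [h1 [x xj h2] h3 h4] := Hd j ji tj; have jm := ltnW ji.
have xi := ltnW (ltn_trans xj ji).
have nk : ~~ btw (ins i.+1 a w) j i.+1 j.+1.
  rewrite new ?(ltn_eqF (ltnSn j)) // negb_or h3 ?mem_head // andbT.
  by apply: contraNneq tj => ->.
split=> //.
- move=> y; rewrite leq_eqVlt => /orP[/eqP->|yi]; first by rewrite (negPf nk).
  by rewrite old //; apply: h1.
- by exists x; rewrite ?old.
by move=> y yq; rewrite old ?(ltnW (qi _ yq)) // h3 // inE yq orbT.
Qed.

Lemma build_invP t i : all (fun j => t j || (fifo t j != [::])) (iota 0 i) ->
  build_inv t i (build t i) (fifo t i).
Proof.
elim: i => [_|i IH]; first by split.
rewrite -addn1 iotaD all_cat /= andbT => /andP[/IH {}IH] {}; rewrite addn1 /= /anchor.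
have [ti _|ti /=] := boolP (t i); first exact: build_inv_open.
by case: (fifo t i) IH => //= a q IH _; apply: build_inv_close.
Qed.

(** The queue ends empty, so only the second alternative of [inv_open] survives: every open arc
    contains a larger letter. *)
Lemma word_of_dyck t m : dyck 0 (map t (iota 0 m)) ->
  [/\ wordp m (build t m), monotone_arcs m (build t m) &
      forall i, i < m -> up (build t m) i = t i].
Proof.
rewrite -[0]/(size (fifo t 0)) dyck_fifo add0n => /andP[/build_invP Hi /eqP Hq].
rewrite Hq in Hi; case: Hi => Hw _ _ Ho Hd.
set w := build t m in Hw Ho Hd *.
have upE i : i < m -> up w i = t i.
  move=> im; have [ti|ti] := boolP (t i).
    have [_ [//|[x xm xi]]] := Ho i im ti.
    by apply/hasP; exists x; rewrite ?(mem_word _ Hw).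
  have [h _ _ _] := Hd i im ti; apply/hasPn => x; rewrite (mem_word _ Hw) => xm.
  by apply/negP => /andP[ix /(h x xm)]; lia.
split=> //; apply/allP => i; rewrite mem_iota => /= im; rewrite upE //.
have [ti|ti] := boolP (t i).
  have [h _] := Ho i im ti; suff /negbTE-> : ~~ dn w i by [].
  apply/hasPn => x; rewrite (mem_word _ Hw) => xm.
  by apply/negP => /andP[ix /(h x xm)]; lia.
have [_ [x xi xb] _ _] := Hd i im ti; suff -> : dn w i by [].
by apply/hasP; exists x; rewrite ?xi // (mem_word _ Hw); lia.
Qed.

(** * Counting Dyck words *)

Lemma dyck_tuple_cons l h (b : bool) :
  #|[set s : l.+1.-tuple bool | dyck h s & thead s == b]| =
  #|[set s : l.-tuple bool | dyck h (b :: s)]|.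
Proof.
rewrite -(card_imset _ (f := fun s : l.-tuple bool => [tuple of b :: s])); last first.
  by move=> s s' /(congr1 val) [] /val_inj.
apply: eq_card => s; case/tupleP: s => c s; rewrite inE theadE.
apply/andP/imsetP => [[Hs /eqP <-]|[s' Hs' [-> /val_inj->]]].
  by exists s; rewrite ?inE.
by rewrite inE in Hs'.
Qed.

Lemma card_dyckS l h :
  #|[set s : l.+1.-tuple bool | dyck h s]| =
  #|[set s : l.-tuple bool | dyck h.+1 s]| +
  (if h is h'.+1 then #|[set s : l.-tuple bool | dyck h' s]| else 0).
Proof.
rewrite -(cardsID [set s : l.+1.-tuple bool | thead s]); congr (_ + _).
  rewrite -(dyck_tuple_cons l h true); apply: eq_card => s.
  by rewrite !inE eqb_id.
transitivity #|[set s : l.-tuple bool | dyck h (false :: s)]|.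
  rewrite -(dyck_tuple_cons l h false); apply: eq_card => s.
  by rewrite !inE eqbF_neg andbC.
case: h => //; apply: eq_card0 => s; by rewrite inE.
Qed.

Lemma dyck_count_true h s : dyck h s -> h + 2 * count id s = size s.
Proof. by elim: s h => [|[] s IH] [|h] //= H; have := IH _ H; lia. Qed.

(* Ballot numbers 'C(l, k) - 'C(l, k - 1), stated without subtraction. *)
Lemma card_dyck_height l h k : h + 2 * k = l ->
  #|[set s : l.-tuple bool | dyck h s]| + (if k is k'.+1 then 'C(l, k') else 0)
  = 'C(l, k).
Proof.
elim: l h k => [|l IH] h k e.
  have [-> ->] : h = 0 /\ k = 0 by lia.
  rewrite (_ : [set _ | _] = setT) ?cardsT ?card_tuple ?expn0 ?bin0 //.
  by apply/setP => s; rewrite !inE tuple0.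
rewrite card_dyckS; case: k e => [|k] e.
  case: h e => [|h] e; first by lia.
  (* Here the height equals the length, so after an up-step too few letters remain to come down. *)
  rewrite (_ : #|_| = 0); last first.
    by apply: eq_card0 => s; rewrite inE; apply/negP => /dyck_count_true; rewrite size_tuple; lia.
  have := IH h 0; rewrite !bin0; lia.
have := IH h.+1 k ltac:(lia); have := binS l k.
case: h e => [|h] e.
  (* Height 0 forces l = 2k+1, and the two middle binomials agree. *)
  have : 'C(l, k.+1) = 'C(l, k) by rewrite -bin_sub; [congr ('C(_, _)); lia | lia].
  by clear; case: k => [|k]; rewrite ?bin0 ?binS; lia.
have := IH h k.+1 ltac:(lia).
by clear; case: k => [|k]; rewrite ?bin0 ?binS; lia.
Qed.

Lemma card_dyck_catalan n :
  n.+1 * #|[set s : (2 * n).-tuple bool | dyck 0 s]| = 'C(2 * n, n).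
Proof.
have := @card_dyck_height (2 * n) 0 n erefl.
case: n => [|n]; first by rewrite mul1n addn0.
(* This gives (n+1) C(2n+2, n+1) = (n+2) C(2n+2, n), so n+2 times the ballot number is the central
   binomial. *)
have := mul_bin_left (2 * n.+1) n; rewrite (_ : 2 * n.+1 - n = n.+2); last by lia.
nia.
Qed.

(** * From permutations to words *)

Lemma up_or_dn m w i : wordp m w -> i < m ->
  up w i || dn w i = (next w i != i.+1).
Proof.
move=> Hw im; have m0 : 0 < m by lia.
have [nm ni Hn] := next_word Hw m0 (ltnW im).
apply/orP/idP => [ud|ne].
  apply/eqP => e; rewrite e in Hn.
  by case: ud => /hasP[x]; rewrite (mem_word _ Hw) => /Hn/negbTE->; rewrite andbF.
have b : btw w i (next w i) i.+1.
  move: (index_neq Hw nm ni) (index_neq Hw nm ne) (Hn i.+1 im).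
  by move: (index_ltn_neq Hw im (ltnSn i)); rewrite /btw /cyc; clear; lia.
have [h|h] := ltnP i.+1 (next w i).
  by left; apply/hasP; exists (next w i); rewrite ?h ?(mem_word _ Hw).
right; apply/hasP; exists (next w i); rewrite ?(mem_word _ Hw) // b andbT; lia.
Qed.

Definition cword (m : nat) (C : 'S_m.+1) : seq nat := map val (cycle_word C).

Lemma cword_word m (C : 'S_m.+1) : full_cycle C ->
  wordp m (cword C) /\ forall x : 'I_m.+1, next (cword C) x = C x.
Proof.
move=> /eqP HC.
have H0 : porbit C ord0 = [set: 'I_m.+1].
  by apply/set1P; rewrite -HC; apply: imset_f.
have c0 : #|porbit C ord0| = m.+1 by rewrite H0 cardsT card_ord.
have ut : uniq (cycle_word C) by have := uniq_traject_porbit C ord0; rewrite c0.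
have mt x : x \in cycle_word C.
  by have := porbit_traject C ord0 x; rewrite c0 H0 inE => <-.
split.
  apply/andP; split; last by rewrite /cword /cycle_word /= eqxx.
  apply: uniq_perm; rewrite ?iota_uniq ?map_inj_uniq //; first exact: val_inj.
  move=> x; rewrite mem_iota /=; apply/mapP/idP => [[y _ ->]|xm]; first exact: ltn_ord.
  by exists (Ordinal xm).
move=> x; rewrite /cword next_map //; last exact: val_inj.
have /next_cycle/(_ (mt x)) /eqP <- // : fcycle C (cycle_word C).
(* After m+1 steps the orbit of 0 returns to 0, which closes the path. *)
rewrite /cycle_word /= -[X in rcons _ X](iter_porbit C ord0) c0 iterSr -trajectSr.
exact: fpath_traject.
Qed.

Lemma cword_inj m (C C' : 'S_m.+1) : full_cycle C -> full_cycle C' ->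
  cword C = cword C' -> C = C'.
Proof.
move=> /cword_word[_ HC] /cword_word[_ HC'] e; apply/permP => x.
by apply: ord_inj; rewrite -HC -HC' e.
Qed.

Lemma cword_surj m w : wordp m w ->
  exists2 C : 'S_m.+1, full_cycle C & cword C = w.
Proof.
move=> Hw; pose s : seq 'I_m.+1 := map inord w.
have sw : map val s = w.
  rewrite -map_comp -[RHS]map_id; apply/eq_in_map => x.
  by rewrite (mem_word _ Hw) => xm; rewrite /= inordK.
have us : uniq s by rewrite -(map_inj_uniq val_inj) sw (uniq_word Hw).
have ms x : x \in s by rewrite -(mem_map val_inj) sw (mem_word _ Hw) leq_ord.
have zs : size s = m.+1 by rewrite -(size_map val) sw; case/andP: Hw => /perm_size->; rewrite size_iota.
(* Each letter is sent to its cyclic successor in [s]. *)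
pose C : 'S_m.+1 := perm (can_inj (prev_next us)).
have Cs : cycle_word C = s.
  have : fcycle C s by rewrite (eq_fcycle (permE _)); apply: cycle_next.
  have : index ord0 s = 0.
    by rewrite -(index_map val_inj) sw; case/andP: Hw => _ /eqP.
  rewrite /cycle_word -[X in traject _ _ X]zs; case: (s) => //= x p; case: eqVneq => // -> _.
  rewrite rcons_path => /andP[/fpathP[k ->] _]; by rewrite size_traject.
exists C; last by rewrite /cword Cs.
have orb x : x \in porbit C ord0.
  have := ms x; rewrite -Cs => /trajectP[k _ ->].
  by rewrite -permX mem_porbit.
apply/eqP/setP => A; rewrite inE; apply/imsetP/eqP => [[x _ ->]|->].
  apply/setP => y; rewrite inE -eq_porbit_mem; apply/eqP.
  by transitivity (porbit C ord0); [|symmetry]; apply/eqP; rewrite eq_porbit_mem.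
by exists ord0 => //; apply/setP => y; rewrite inE orb.
Qed.

(** * Nontrivial occurrences and arcs *)

Lemma cyc_betweenE m (C : 'S_m.+1) a x b : cyc_between C a x b = btw (cword C) a x b.
Proof. by rewrite /cyc_between /pos /btw /cyc /cword !(index_map val_inj). Qed.

Lemma mu_occP m (C : 'S_m.+1) (a b : 'I_m.+1) :
  reflect (a < b /\ forall x, a < x < b -> ~~ btw (cword C) a x b) (mu_occ C a b).
Proof.
apply: (iffP andP) => [[ab /existsPn H]|[ab H]]; split=> //.
  move=> x xab; have xm : x < m.+1 by have := ltn_ord b; lia.
  by have := H (Ordinal xm); rewrite cyc_betweenE /= xab.
by apply/existsPn => x; rewrite cyc_betweenE negb_and -implybE; apply/implyP/H.
Qed.

Lemma card_up_le_NT m (C : 'S_m.+1) : full_cycle C ->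
  #|[set i : 'I_m | up (cword C) i]| <= NT_mu C.
Proof.
move=> HC; have [Hw _] := cword_word HC; set w := cword C in Hw *.
(* [lift ord_max] keeps the value i, the first entry of the occurrence. *)
rewrite -(@card_imset 'I_m 'I_m.+1 _ _ (@lift_inj _ ord_max)) /NT_mu.
apply: leq_trans (leq_imset_card fst _); apply: subset_leq_card.
apply/subsetP => _ /imsetP[i + ->]; rewrite inE => ui.
have ex : exists x, [&& x <= m, i.+1 < x & btw w i x i.+1].
  by case/hasP: ui => x; rewrite (mem_word _ Hw) => xm /andP[xi xb]; exists x; rewrite xm xi.
case: (ex_minnP ex) => x /and3P[xm xi xb] xmin.
have xm1 : x < m.+1 by [].
apply/imsetP; exists (lift ord_max i, Ordinal xm1) => //.
rewrite inE; apply/andP; split; last by rewrite lift_max.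
apply/(@mu_occP m C (lift ord_max i) (Ordinal xm1)); rewrite lift_max; split=> [|z /=/andP[iz zx]]; first exact: ltnW.
have zm : z <= m by lia.
apply/negP => /= zb.
have ne : z != i.+1.
  by apply: contraTneq zb => ->; move: xb; rewrite -/w /btw /cyc; clear; lia.
suff: x <= z by lia.
by apply: xmin; rewrite zm /=; apply/andP; split;
  [lia | move: xb zb; rewrite -/w /btw /cyc; clear; lia].
Qed.

Lemma card_dn_le_NT m (C : 'S_m.+1) : full_cycle C ->
  #|[set i : 'I_m | dn (cword C) i]| <= NT_mu C.
Proof.
move=> HC; have [Hw _] := cword_word HC; set w := cword C in Hw *.
(* [lift ord0] sends i to i+1, the second entry of the occurrence. *)
rewrite -(@card_imset 'I_m 'I_m.+1 _ _ (@lift_inj _ ord0)) /NT_mu.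
apply: leq_trans (leq_imset_card snd _); apply: subset_leq_card.
apply/subsetP => _ /imsetP[i + ->]; rewrite inE => ui.
have ex : exists x, (x < i) && btw w i x i.+1 by case/hasP: ui => x _; exists x.
have bd x : (x < i) && btw w i x i.+1 -> x <= i by case/andP=> /ltnW.
case: (ex_maxnP ex bd) => x /andP[xi xb] xmax.
have xm1 : x < m.+1 by have := ltn_ord i; lia.
apply/imsetP; exists (Ordinal xm1, lift ord0 i) => //.
rewrite inE /= /bump /= add1n ltnS xi andbT; apply/mu_occP.
rewrite /= /bump /= add1n; split=> [|z /=/andP[iz zx]]; first exact: leqW.
apply/negP => /= zb.
have ne : z != i.
  by apply: contraTneq zb => ->; move: xb; rewrite -/w /btw /cyc; clear; lia.
suff: z <= x by lia.
by apply: xmax; apply/andP; split;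
  [lia | move: xb zb; rewrite -/w /btw /cyc; clear; lia].
Qed.

(** Neither a+1 nor b-1 lies between a and b, so b is on the arc from a to a+1, and a is on the arc
    from b-1 to b. Thus a is open and b-1 closed. A letter between a and b would be on both arcs,
    hence strictly between a+1 and b-1 in value, against the occurrence. *)
Lemma mu_occ_arc m (C : 'S_m.+1) (a b : 'I_m.+1) : full_cycle C ->
  monotone_arcs m (cword C) -> mu_occ C a b -> a.+1 < b ->
  up (cword C) a /\ forall x, x <= m -> ~~ btw (cword C) a x b.
Proof.
move=> HC; have [Hw _] := cword_word HC; set w := cword C in Hw * => Hm.
move=> /mu_occP[_ H] ab; rewrite -/w in H; have bm : b <= m by rewrite -ltnS.
have am : a < m by lia.
have e : (b.-1).+1 = b :> nat by lia.
have b1m : b.-1 < m by lia.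
have h1 : ~~ btw w a a.+1 b by apply: H; rewrite ltnSn.
have h2 : ~~ btw w a b.-1 b by apply: H; lia.
have n1 := index_ltn_neq Hw bm ab.
have n2 := index_ltn_neq Hw am (ltnSn a).
have n3 := index_ltn_neq Hw bm (ltnW ab).
have n4 : index b.-1 w != index (b : nat) w by apply: (index_ltn_neq Hw bm); lia.
have n5 : index (a : nat) w != index b.-1 w by apply: (index_ltn_neq Hw); lia.
have ba : btw w a b a.+1 by move: h1 n1 n2 n3; rewrite /btw /cyc; clear; lia.
have ab1 : btw w b.-1 a b by move: h2 n3 n4 n5; rewrite /btw /cyc; clear; lia.
have ua : up w a by apply/hasP; exists (b : nat); rewrite ?(mem_word _ Hw) // ab.
have ub : ~~ up w b.-1.
  apply/negP => ub; have := @upP _ _ _ a Hw Hm b1m ub (ltnW am).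
  by rewrite e => /(_ ab1); lia.
split=> // x xm; apply/negP => xb.
have := upP Hw Hm am ua xm; have := dnP Hw b1m ub xm; rewrite e.
have -> : btw w a x a.+1 by move: xb ba; rewrite /btw /cyc; clear; lia.
have -> : btw w b.-1 x b by move: xb ab1; rewrite /btw /cyc; clear; lia.
move=> /(_ isT) xb1 /(_ isT) ax.
by have := H x; rewrite xb => /(_ _)/negP; apply => //; lia.
Qed.

(** Two occurrences with the same first entry coincide, since each second entry follows it
    immediately. *)
Lemma NT_le_card_up m (C : 'S_m.+1) : full_cycle C ->
  monotone_arcs m (cword C) ->
  NT_mu C <= #|[set i : 'I_m | up (cword C) i]|.
Proof.
move=> HC Hm; have [Hw _] := cword_word HC.
rewrite -(@card_imset 'I_m 'I_m.+1 _ _ (@lift_inj _ ord_max)) /NT_mu.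
rewrite -(card_in_imset (f := fst)); last first.
  move=> [a b] [a' b']; rewrite !inE /= => /andP[ab ltab] /andP[ab' ltab'] ea.
  rewrite -{a'}ea in ab' ltab' *; congr (_, _); apply/eqP/negPn/negP => ne.
  have {}ne : (b : nat) != b' := ne.
  have bm : b <= m by rewrite -ltnS.
  have bm' : b' <= m by rewrite -ltnS.
  have [_ /(_ b' bm')] := mu_occ_arc HC Hm ab ltab.
  have [_ /(_ b bm)] := mu_occ_arc HC Hm ab' ltab'.
  move: (index_ltn_neq Hw bm (ltnW ltab)) (index_ltn_neq Hw bm' (ltnW ltab')).
  by move: (index_neq Hw bm ne); rewrite /btw /cyc; clear; lia.
apply: subset_leq_card; apply/subsetP => _ /imsetP[[a b] + ->].
rewrite inE /= => /andP[ab ltab].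
have [ua _] := mu_occ_arc HC Hm ab ltab.
have am : a < m by have := ltn_ord b; lia.
apply/imsetP; exists (Ordinal am); rewrite ?inE //.
by apply: ord_inj; rewrite lift_max.
Qed.

Lemma card_up m w : #|[set i : 'I_m | up w i]| = count id (map (up w) (iota 0 m)).
Proof.
rewrite count_map -sum1_count -sum1_card -[m in iota 0 m]subn0 big_mkord.
by apply: eq_bigl => i; rewrite inE.
Qed.

(* Exactly half of the 2n arcs are open in a Dyck word, hence NT_mu C = n.    *)
Lemma minimal_NT n (C : 'S_(2 * n).+1) :
  (C \in IC (2 * n)) && (NT_mu C == n) =
  full_cycle C && monotone_arcs (2 * n) (cword C).
Proof.
rewrite inE -andbA; apply: andb_id2l => HC.
have [Hw HE] := cword_word HC; set w := cword C in Hw HE *.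
have incE : incontractible C = [forall i : 'I_(2 * n), up w i || dn w i].
  apply/existsPn/forallP => H i; last first.
    have [im|] := ltnP i (2 * n); last by rewrite negb_and ltnS; lia.
    by rewrite ltnS im /= -HE -(up_or_dn Hw im) (H (Ordinal im)).
  have := H (lift ord_max i); rewrite -HE lift_max ltnS ltn_ord /=.
  by rewrite (up_or_dn Hw (ltn_ord i)).
rewrite incE; apply/andP/idP => [[/forallP Hi /eqP HN]|Hm]; last first.
  split.
    apply/forallP => i; have := allP Hm i; rewrite mem_iota ltn_ord => /(_ isT).
    by case: up; case: dn.
  rewrite eqn_leq; have := dyck_count_true (dyck_of_word Hw Hm).
  rewrite -card_up size_map size_iota.
  have := card_up_le_NT HC; have := NT_le_card_up HC Hm; rewrite -/w; lia.
have := card_up_le_NT HC; have := card_dn_le_NT HC; rewrite -/w HN.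
set D := [set i : 'I__ | dn w i]; set U := [set i : 'I__ | up w i] => hD hU.
have := cardsUI U D; rewrite (_ : U :|: D = setT) ?cardsT ?card_ord; last first.
  by apply/setP => i; rewrite !inE Hi.
(* [U] and [D] have at most n elements each and together cover all 2n arcs. *)
move=> e; have /eqP : #|U :&: D| = 0 by lia.
rewrite cards_eq0 => /eqP/setP UD; apply/allP => i; rewrite mem_iota => /= im.
have := UD (Ordinal im); have := Hi (Ordinal im); rewrite !inE /=.
by case: up; case: dn.
Qed.

(** * The bijection with Dyck words and the coefficient *)

Lemma card_minimal_NT n :
  #|[set C : 'S_(2 * n).+1 | (C \in IC (2 * n)) && (NT_mu C == n)]| =
  #|[set s : (2 * n).-tuple bool | dyck 0 s]|.
Proof.
pose F (C : 'S_(2 * n).+1) := [tuple up (cword C) i | i < 2 * n].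
have FE C : F C = map (up (cword C)) (iota 0 (2 * n)) :> seq bool.
  by rewrite /= -val_enum_ord -map_comp.
rewrite -(card_in_imset (f := F)) => [|C C'].
  apply: eq_card => s; rewrite !inE; apply/imsetP/idP => [[C + ->]|Hs].
    rewrite inE minimal_NT FE => /andP[/cword_word[Hw _] Hm].
    exact: dyck_of_word.
  have sE : map (nth false s) (iota 0 (2 * n)) = s.
    by rewrite -[X in iota 0 X](size_tuple s) map_nth_iota0 // take_size.
  have [Hw Hm ut] := @word_of_dyck (nth false s) (2 * n) ltac:(by rewrite sE).
  have [C HC Cw] := cword_surj Hw.
  exists C; first by rewrite inE minimal_NT HC Cw.
  apply/val_inj/(etrans (esym sE))/(etrans _ (esym (FE C))); rewrite Cw.
  apply/eq_in_map => i.
  by rewrite mem_iota => /= im; rewrite ut.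
rewrite inE minimal_NT => /andP[HC Hm].
rewrite inE minimal_NT => /andP[HC' Hm'] /(congr1 (@tval _ _)).
rewrite !FE => /eq_in_map E; apply: cword_inj => //.
have [Hw _] := cword_word HC; have [Hw' _] := cword_word HC'.
by apply: (word_up_inj Hw Hw') => // i im; apply: E; rewrite mem_iota.
Qed.

Local Open Scope ring_scope.

Theorem corollary10 (n : nat) (hn : (1 <= n)%N) :
  ((NTI_mu (2 * n).+1)`_n)%:~R = catalan n.
Proof.
rewrite /NTI_mu /catalan coef_sum -card_dyck_catalan -card_minimal_NT.
rewrite natrM mulKf ?pnatr_eq0 // -sum1_card natr_sum rmorph_sum /=.
under [RHS]eq_bigl do rewrite in_set.
rewrite [RHS]big_mkcondr /=.
by apply: eq_bigr => C _; rewrite coefXn eq_sym; case: eqP.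
Qed.
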